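(* Let $\frac pq$ be an irreducible fraction with $1\le p\le q$. Then $$\overline{v\bigl(\phi(\tfrac pq)\bigr)}=v\bigl(\phi(\tfrac{q-p}{q})\bigr).$$
   Context: Notation. $\Lambda=\mathbb{Z}[A,A^{-1}]$, $\delta=-A^2-A^{-2}$, and $\Lambda^2=\Lambda[\infty]\oplus\Lambda[0]$ is the free $\Lambda$-module with basis $[\infty],[0]$. The map $v:\Lambda^2\to\Lambda$ is $v(a[\infty]+b[0])=a\delta+b$. The bar $\overline{(\cdot)}:\Lambda\to\Lambda$ is the ring involution exchanging $A$ and $A^{-1}$. Farey sums. Irreducible fractions have non-negative denominator, with $0=\frac01$, $\infty=\frac10$. Fractions $\frac pq,\frac rs$ (listed in ascending order) are Farey neighbors if $qr-ps=1$; their Farey sum is $\frac pq\sharp\frac rs=\frac{p+r}{q+s}$. Each positive rational $\alpha$ is $y\sharp z$ for a unique pair $(y,z)$ of Farey neighbors, called the pair of parents of $\alpha$. Ancestor triangle. Let $\alpha$ be a positive rational. Put $(y_1,z_1)=(\frac01,\frac10)$ and $m_i=y_i\sharp z_i$. If $m_i=\alpha$ stop and put $N=i$; otherwise $(y_{i+1},z_{i+1})=(m_i,z_i)$ if $\alpha>m_i$ and $(y_i,m_i)$ if $\alpha<m_i$. The ancestor triangle of $\alpha$ is the planar triangle with upper left corner $\frac01$, upper right corner $\frac10$ and bottom corner $\alpha$, decomposed into the $N$ fundamental triangles with vertices $y_i$ (upper left), $z_i$ (upper right), $m_i$ (bottom), $i=1,\ldots,N$, the $(i+1)$-st glued below the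 $i$-th along the edge $y_{i+1}z_{i+1}$. Its left oblique side is the chain of edges through the distinct $y_i$'s from $\frac01$ down to $\alpha$, and its right oblique side is the chain of edges through the distinct $z_i$'s from $\frac10$ down to $\alpha$; $l(\alpha)$, $r(\alpha)$ are the numbers of edges on the left and right oblique sides. For $\ast\in\{0,\infty\}$, $P_\ast(\alpha)$ is the set of descending paths from $\ast$ to $\alpha$, i.e. edge paths in the ancestor triangle in which each step goes from a vertex to a vertex of which it is a parent. Such a path $\gamma$ cuts the ancestor triangle into a left and a right part; $w_L(\gamma)$, $w_R(\gamma)$ are the numbers of fundamental triangles on the left and on the right of $\gamma$. The map $\phi$ from the non-negative rationals together with $\infty$ to $\Lambda^2$ is defined by $\phi(\infty)=A^6[\infty]$, $\phi(0)=[0]$ and, for rational $\alpha>0$, $$\phi(\alpha)=\Bigl(A^6(-A^4)^{-r(\alpha)}\sum_{\gamma\in P_\infty(\alpha)}(-A^4)^{w_R(\gamma)}\Bigr)[\infty]+\Bigl((-A^4)^{l(\alpha)}\sum_{\gamma\in P_0(\alpha)}(-A^4)^{-w_L(\gamma)}\Bigr)[0].$$ *)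

(* Defs.v *)
From HB Require Import structures.
From mathcomp Require Import all_boot all_order all_algebra finmap.
From mathcomp Require Import monalg zify.
From mathcomp Require Import boolp classical_sets functions cardinality fsbigop.

Set Implicit Arguments.
Unset Strict Implicit.
Unset Printing Implicit Defensive.

Import GRing.Theory.

Local Open Scope ring_scope.

(** * The ring Z[A, A^-1] *)

(* An element is a finitely supported family of integers indexed by the       *)
(* exponents of A.  [monalg] gives the additive group; it has no product here *)
(* because its [monomType] excludes index monoids with nontrivial units.      *)
Definition laurent : Type := {malg int[int]}.
HB.instance Definition _ := GRing.Zmodule.on laurent.

Implicit Types (f g h : laurent) (i j k : int).

Definition monom (c k : int) : laurent := << c *g k >>.

HB.lock Definition laurent_mul (f g : laurent) : laurent :=
  \sum_(i <- msupp f) \sum_(j <- msupp g) monom (f@_i * g@_j) (i + j).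

Lemma laurent_mul_def f g : laurent_mul f g =
  \sum_(i <- msupp f) \sum_(j <- msupp g) monom (f@_i * g@_j) (i + j).
Proof. by rewrite unlock. Qed.

Lemma mcoeff_monom c i k : (monom c i)@_k = c *+ (i == k).
Proof. exact: mcoeffU. Qed.

Lemma laurentE f : f = \sum_(i <- msupp f) monom f@_i i.
Proof. exact: monalgE. Qed.

Lemma monom0 k : monom 0 k = 0. Proof. exact: monalgU0. Qed.

Lemma monomD c d k : monom (c + d) k = monom c k + monom d k.
Proof. exact: monalgUD. Qed.

Lemma laurent_mulEw (d e : {fset int}) f g :
    (msupp f `<=` d)%fset -> (msupp g `<=` e)%fset ->
  laurent_mul f g = \sum_(i <- d) \sum_(j <- e) monom (f@_i * g@_j) (i + j).
Proof.
move=> led lee; rewrite laurent_mul_def (big_fset_incl _ led) /=; last first.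
  by move=> i _ /mcoeff_outdom ->; apply: big1 => j _; rewrite mul0r monom0.
apply: eq_bigr => i _; apply: big_fset_incl => // j _ /mcoeff_outdom ->.
by rewrite mulr0 monom0.
Qed.

Fact laurent_mulC : commutative laurent_mul.
Proof.
move=> f g; rewrite !laurent_mul_def exchange_big; apply: eq_bigr => i _.
by apply: eq_bigr => j _; rewrite mulrC addrC.
Qed.

Fact laurent_mulDl : left_distributive laurent_mul +%R.
Proof.
move=> f1 f2 g; have sg := fsubset_refl (msupp g).
rewrite (laurent_mulEw (msuppD_le f1 f2) sg).
rewrite (laurent_mulEw (fsubsetUl _ (msupp f2)) sg).
rewrite (laurent_mulEw (fsubsetUr (msupp f1) _) sg).
rewrite -big_split; apply: eq_bigr => i _ /=.
rewrite -big_split; apply: eq_bigr => j _ /=.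
by rewrite mcoeffD mulrDl monomD.
Qed.

Lemma laurent_mulMM c d i j :
  laurent_mul (monom c i) (monom d j) = monom (c * d) (i + j).
Proof.
by rewrite (laurent_mulEw msuppU_le msuppU_le) !big_seq_fset1 !mcoeffUU.
Qed.

Lemma laurent_mulEl f g :
  laurent_mul f g = \sum_(i <- msupp f) laurent_mul (monom f@_i i) g.
Proof.
rewrite laurent_mul_def; apply: eq_bigr => i _.
by rewrite (laurent_mulEw msuppU_le (fsubset_refl _)) big_seq_fset1 mcoeffUU.
Qed.

Lemma laurent_mul_suml (s : seq int) (F : int -> laurent) g :
  laurent_mul (\sum_(i <- s) F i) g = \sum_(i <- s) laurent_mul (F i) g.
Proof.
apply: (big_morph (laurent_mul^~ g) (fun _ _ => laurent_mulDl _ _ _)).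
by rewrite laurent_mul_def msupp0 big_seq_fset0.
Qed.

Lemma laurent_mulMEr c i g :
  laurent_mul (monom c i) g = \sum_(j <- msupp g) monom (c * g@_j) (i + j).
Proof.
rewrite laurent_mulC laurent_mulEl; apply: eq_bigr => j _.
by rewrite laurent_mulMM mulrC addrC.
Qed.

Fact laurent_mulA : associative laurent_mul.
Proof.
move=> f g h; rewrite (laurent_mulEl f g) laurent_mul_suml.
rewrite (laurent_mulEl f); apply: eq_bigr => i _.
rewrite (laurent_mulMEr _ _ g) laurent_mul_suml.
rewrite (laurent_mulEl g) laurent_mulC laurent_mul_suml; apply: eq_bigr => j _.
rewrite !(laurent_mulMEr _ _ h) laurent_mul_suml; apply: eq_bigr => k _.
by rewrite laurent_mulMM mulrC mulrA [j + k + i]addrC addrA.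
Qed.

Fact laurent_mul1 : left_id (monom 1 0) laurent_mul.
Proof.
move=> f; rewrite laurent_mulMEr [RHS]laurentE; apply: eq_bigr => i _.
by rewrite mul1r add0r.
Qed.

Fact laurent_1neq0 : monom 1 0 != 0.
Proof. by rewrite /monom monalgU_eq0. Qed.

HB.instance Definition _ := GRing.Zmodule_isComNzRing.Build laurent
  laurent_mulA laurent_mulC laurent_mul1 laurent_mulDl laurent_1neq0.

Definition laurent_unit : {pred laurent} := [pred f | `[< exists g, g * f = 1 >]].

Definition laurent_inv f : laurent :=
  if pselect (exists g, g * f = 1) is left ex then projT1 (cid ex) else f.

Fact laurent_mulVf : {in laurent_unit, left_inverse 1 laurent_inv *%R}.
Proof.
move=> f /asboolP ex; rewrite /laurent_inv.
by case: pselect => // ex'; case: cid.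
Qed.

Fact laurent_unitPl f g : g * f = 1 -> f \in laurent_unit.
Proof. by move=> gf; apply/asboolP; exists g. Qed.

Fact laurent_inv_out : {in [predC laurent_unit], laurent_inv =1 id}.
Proof.
move=> f /negP nf; rewrite /laurent_inv; case: pselect => // ex.
by case: nf; apply/asboolP.
Qed.

HB.instance Definition _ := GRing.ComNzRing_hasMulInverse.Build laurent
  laurent_mulVf laurent_unitPl laurent_inv_out.

Definition A : laurent := monom 1 1.

Lemma monomM c d i j : monom c i * monom d j = monom (c * d) (i + j).
Proof. exact: laurent_mulMM. Qed.

Lemma A_unit : A \is a GRing.unit.
Proof. by apply/unitrPr; exists (monom 1 (- 1)); rewrite monomM. Qed.

Lemma A_inv : A^-1 = monom 1 (- 1).
Proof. by apply: (mulrI A_unit); rewrite divrr ?A_unit // monomM. Qed.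

Lemma A_exp k : A ^ k = monom 1 k.
Proof.
have Xn n : A ^+ n = monom 1 n%:Z.
  by elim: n => // n IHn; rewrite exprS IHn monomM mulr1 -intS.
have Vn n : A ^- n = monom 1 (- n%:Z).
  apply: (mulrI (unitrX n A_unit)); rewrite divrr ?unitrX ?A_unit //.
  by rewrite Xn monomM subrr.
by case: k => n; [exact: Xn | rewrite NegzE; exact: Vn].
Qed.

Definition delta : laurent := - A ^+ 2 - A ^- 2.

HB.lock Definition bar (f : laurent) : laurent := \sum_(i <- msupp f) monom f@_i (- i).

Lemma mcoeff_bar f k : (bar f)@_k = f@_(- k).
Proof.
rewrite bar.unlock [RHS](congr1 (mcoeff (- k)) (laurentE f)).
rewrite (raddf_sum (mcoeff k)) (raddf_sum (mcoeff (- k))).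
by apply: eq_bigr => i _; rewrite /= !mcoeff_monom eqr_oppLR.
Qed.

Lemma bar_monom c k : bar (monom c k) = monom c (- k).
Proof. by apply/malgP => j; rewrite mcoeff_bar !mcoeff_monom eqr_oppLR. Qed.

Fact bar_is_zmod_morphism : zmod_morphism bar.
Proof. by move=> f g; apply/malgP => k; rewrite mcoeffB !mcoeff_bar mcoeffB. Qed.

HB.instance Definition _ :=
  GRing.isZmodMorphism.Build laurent laurent bar bar_is_zmod_morphism.

Fact bar_is_monoid_morphism : monoid_morphism bar.
Proof.
split=> [|f g]; first exact: bar_monom.
rewrite (laurentE f) (laurentE g) !(raddf_sum bar) !mulr_suml (raddf_sum bar).
apply: eq_bigr => i _; rewrite !mulr_sumr (raddf_sum bar).
by apply: eq_bigr => j _; rewrite /= monomM !bar_monom monomM opprD.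
Qed.

HB.instance Definition _ :=
  GRing.isMonoidMorphism.Build laurent laurent bar bar_is_monoid_morphism.

Lemma barK : involutive bar.
Proof. by move=> f; apply/malgP => k; rewrite !mcoeff_bar opprK. Qed.

Lemma bar_A : bar A = A^-1.
Proof. by rewrite A_inv bar_monom. Qed.

(** * The free module with basis [oo], [0] *)

Definition laurent2 : Type := (laurent^o * laurent^o)%type.
HB.instance Definition _ := GRing.Lmodule.on laurent2.

Definition b_oo : laurent2 := (1, 0).
Definition b_0 : laurent2 := (0, 1).

Definition v (x : laurent2) : laurent := x.1 * delta + x.2.

Lemma vE (a b : laurent) : v (a *: b_oo + b *: b_0) = a * delta + b.
Proof.
by rewrite /v /= /GRing.scale /= !mulr1 !mulr0 addr0 add0r.
Qed.

Local Close Scope ring_scope.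
Local Open Scope nat_scope.

(** * Farey sums *)

(* (p, q) stands for p/q; only pairs with coprime entries are meaningful.     *)
Definition frac : Type := (nat * nat)%type.
HB.instance Definition _ := Countable.on frac.

Definition fr0 : frac := (0, 1).
Definition fr_oo : frac := (1, 0).

Implicit Types (x y z u w a : frac).

Definition frac_lt x y : bool := x.1 * y.2 < y.1 * x.2.

(* For x = p/q and y = r/s: qr - ps = 1, which forces x < y.                  *)
Definition farey_nbr x y : bool := x.2 * y.1 == x.1 * y.2 + 1.

Definition farey_sum x y : frac := (x.1 + y.1, x.2 + y.2).

Definition parents y z a : bool := farey_nbr y z && (farey_sum y z == a).

(* The only possible other parent of w is the entrywise difference.           *)
Definition is_parent u w : bool :=
  let u' : frac := (w.1 - u.1, w.2 - u.2) in parents u u' w || parents u' u w.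

Lemma is_parentP u w :
  reflect (exists u', parents u u' w \/ parents u' u w) (is_parent u w).
Proof.
apply: (iffP orP) => [[h|h]|[[r s] [] h]]; try by eexists; eauto.
  left; case/andP: (h) => _ /eqP def_w; rewrite -def_w /= !addKn.
  by rewrite def_w.
right; case/andP: (h) => _ /eqP def_w; rewrite -def_w /= !addnK.
by rewrite def_w.
Qed.

(** * The ancestor triangle *)

(* The fundamental triangle with upper left corner y, upper right corner z    *)
(* and bottom corner farey_sum y z is represented by (y, z).                  *)
Definition triangle : Type := (frac * frac)%type.
HB.instance Definition _ := Countable.on triangle.

Implicit Types t : triangle.

Definition bottom t : frac := farey_sum t.1 t.2.

Fixpoint ancestors_from (n : nat) a t : seq triangle :=
  if n is n'.+1 then
    let m := bottom t in
    t :: if m == a then [::]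
         else ancestors_from n' a (if frac_lt m a then (m, t.2) else (t.1, m))
  else [::].

(* The triangles (y_i, z_i) from top to bottom.  The fuel is sufficient: the  *)
(* sum of the entries of m_i increases with i, and it is at most a.1 + a.2;   *)
(* see [bottom_last_ancestors].                                               *)
Definition ancestors a : seq triangle :=
  ancestors_from (a.1 + a.2) a (fr0, fr_oo).

Lemma bottom_last_ancestors a : coprime a.1 a.2 -> 0 < a.1 -> 0 < a.2 ->
  bottom (last (fr0, fr_oo) (ancestors a)) = a.
Proof.
have gen n t t0 c d : farey_nbr t.1 t.2 -> coprime c d -> 0 < c -> 0 < d ->
    a = (c * t.1.1 + d * t.2.1, c * t.1.2 + d * t.2.2) -> c + d <= n ->
  bottom (last t0 (ancestors_from n a t)) = a.
- elim: n t t0 c d => [|n IHn] [[y1 y2] [z1 z2]] t0 c d /= nyz cd c0 d0 def_a.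
    by case: c c0 cd def_a.
  move=> le_n; have nyz1 : y2 * z1 = y1 * z2 + 1 by apply/eqP.
  have [bot_a|bot_a] := eqVneq; first by [].
  have lt_a : frac_lt (bottom (y1, y2, (z1, z2))) a = (c < d).
    rewrite def_a /frac_lt /=.
    move: (congr1 (muln c) nyz1) (congr1 (muln d) nyz1); clear; lia.
  have [c_lt_d|d_lt_c|c_eq_d] := ltngtP c d.
  + rewrite lt_a c_lt_d; apply: (IHn _ _ c (d - c)) => /=.
    * by rewrite /farey_nbr /=; apply/eqP; lia.
    * by rewrite /coprime -(gcdnDl c) subnKC // ltnW.
    * by [].
    * by rewrite subn_gt0.
    * by rewrite def_a -{1 2}(subnKC (ltnW c_lt_d)); congr pair; lia.
    * by lia.
  + rewrite lt_a ltnNge (ltnW d_lt_c) /=; apply: (IHn _ _ (c - d) d) => /=.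
    * by rewrite /farey_nbr /=; apply/eqP; lia.
    * move: cd; rewrite -{1}(subnKC (ltnW d_lt_c)) coprime_sym /coprime.
      by rewrite gcdnDl gcdnC.
    * by rewrite subn_gt0.
    * by [].
    * by rewrite def_a -{1 2}(subnKC (ltnW d_lt_c)); congr pair; lia.
    * by lia.
  + case/eqP: bot_a; rewrite def_a -c_eq_d.
    have -> : c = 1 by apply/eqP; move: cd; rewrite -c_eq_d /coprime gcdnn.
    by rewrite !mul1n.
move=> cop a1 a2; apply: (gen _ _ _ a.2 a.1); rewrite //= 1?coprime_sym //.
  by case: (a) => p q /=; rewrite !(muln0, muln1, addn0).
by rewrite addnC.
Qed.

Definition corners t : seq frac := [:: t.1; t.2; bottom t].

Definition edge_of t u w : bool :=
  [&& u != w, u \in corners t & w \in corners t].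

(* Equal y_i's are consecutive, and so are equal z_i's, so [undup] preserves   *)
(* the order of the chain.                                                    *)
Definition left_side a : seq frac := rcons (undup (unzip1 (ancestors a))) a.
Definition right_side a : seq frac := rcons (undup (unzip2 (ancestors a))) a.

Definition edges (s : seq frac) : seq (frac * frac) := zip s (behead s).

Definition lnum a : nat := size (edges (left_side a)).
Definition rnum a : nat := size (edges (right_side a)).

Definition descends a u w : bool :=
  is_parent u w && has (fun t => edge_of t u w) (ancestors a).

(* A path is the sequence of its vertices, starting point included.           *)
Definition is_desc_path a x (s : seq frac) : bool :=
  if s is x0 :: s' then [&& x0 == x, path (descends a) x s' & last x s' == a]
  else false.

Definition desc_paths x a : set (seq frac) := [set s | is_desc_path a x s].

Lemma finite_desc_paths x a : finite_set (desc_paths x a).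
Proof.
pose V := x :: flatten [seq corners t | t <- ancestors a].
have finB n : finite_set [set s : seq frac | all (mem V) s && (size s <= n)].
  elim: n => [|n IHn].
    apply: sub_finite_set (finite_set1 [::]) => s /andP[_].
    by rewrite leqn0 => /nilP.
  apply: (@sub_finite_set _ _ ([set [::]] `|`
      [set u :: s | u in [set` V] & s in
        [set s : seq frac | all (mem V) s && (size s <= n)]])%classic).
    move=> [|u s]; [by left | move=> /andP[/= /andP[Vu Vs] le_n]; right].
    by exists u => //; exists s => //=; rewrite Vs.
  rewrite finite_setU; split; first exact: finite_set1.
  exact: finite_image2 (finite_seq _) IHn.
apply: sub_finite_set (finB (size V)) => -[//|_ s /and3P[/eqP-> x_s _]].
have VS u w : descends a u w -> w \in V.
  case/andP=> _ /hasP[t at_ /and3P[_ _ tw]]; rewrite inE; apply/orP; right.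
  by apply/flatten_mapP; exists t.
pose wt w := w.1 + w.2.
have lt_wt u w : descends a u w -> wt u < wt w.
  case/andP=> /is_parentP[[p q] [] /andP[/eqP nb /eqP <-]] _;
  rewrite /wt /=; case: p q nb => [|p] [|q] /=;
  rewrite ?muln0 ?mul0n; move=> *; lia.
have Vxs : all (mem V) (x :: s).
  by rewrite /= inE eqxx /=; elim: s (x) x_s => //= w s IHs u /andP[/VS -> /IHs].
suff: all (mem V) (x :: s) && (size (x :: s) <= size V) by [].
rewrite Vxs uniq_leq_size //; last exact/allP.
apply: (@map_uniq _ _ wt); apply: (sorted_uniq ltn_trans ltnn).
by rewrite /= path_map; apply: sub_path x_s => u w; exact: lt_wt.
Qed.

Definition uses (s : seq frac) u w : bool :=
  ((u, w) \in edges s) || ((w, u) \in edges s).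

Definition tri a (i : nat) : triangle := nth (fr0, fr_oo) (ancestors a) i.

(* Triangle n is glued right below triangle m, along the edge joining the     *)
(* upper corners of triangle n, and the path s does not run along that edge.  *)
Definition glued_below a s : rel 'I_(size (ancestors a)) :=
  fun m n => (n == m.+1 :> nat) && ~~ uses s (tri a n).1 (tri a n).2.

(* The triangles from which some edge of the given oblique side, not itself   *)
(* on the path s, can be reached without crossing s.                          *)
Definition part_along (side : seq frac) a s : {set 'I_(size (ancestors a))} :=
  let adjacent m n := glued_below s m n || glued_below s n m in
  [set m | [exists n, connect adjacent m n &&
    has (fun e => edge_of (tri a n) e.1 e.2 && ~~ uses s e.1 e.2) (edges side)]].

Definition w_L a s : nat := #|part_along (left_side a) a s|.
Definition w_R a s : nat := #|part_along (right_side a) a s|.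

(** * The map phi *)

Local Open Scope ring_scope.

Definition phi a : laurent2 :=
  if a == fr_oo then A ^+ 6 *: b_oo
  else if a == fr0 then b_0
  else
    (A ^+ 6 * (- A ^+ 4) ^- rnum a
       * \sum_(s \in desc_paths fr_oo a) (- A ^+ 4) ^+ w_R a s) *: b_oo
    + ((- A ^+ 4) ^+ lnum a
       * \sum_(s \in desc_paths fr0 a) (- A ^+ 4) ^- w_L a s) *: b_0.

(* Main.v *)
Require Import Defs.
From mathcomp Require Import all_boot all_order all_algebra.
From mathcomp Require Import zify.
From mathcomp Require Import boolp classical_sets fsbigop.

Import GRing.Theory.
(* Makes [frac] the type of Farey fractions again. *)
Import Defs.

Set Implicit Arguments.
Unset Strict Implicit.
Unset Printing Implicit Defensive.

(** Put [q = - A^4], the element [q4] below, so that the bar involution inverts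
    [q], and [A^6 * delta = q - q^2].

    An ancestor triangle is a strip: it is determined by a word [ts] of turns,
    one letter for each triangle but the last, which says whether the next
    triangle replaces the right ([true]) or the left ([false]) upper corner.
    A descending path passes through an upper corner of every triangle, and the
    last such corner lies on its left or its right: the path is recorded by a
    word of sides [b_0 b_1 ...], one letter for each triangle.  At each turn the
    path either moves to the new vertex, so that [b_(i+1)] is the turn, or stays
    where it is, which is possible only on the side that the turn keeps; so
    [b_(i+1)] is [ts_i] or [b_i].  Paths from [oo] (from [0]) are in bijection
    with such words starting with [true] (with [false]); see
    [desc_paths_words].

    The edge along which two consecutive triangles are glued is on the path
    exactly when their letters differ ([uses_glue]); hence the triangles on the
    left of the path are those with letter [true], those on its right are those
    with letter [false] ([part_along_side]), and [w_L] and [w_R] count letters.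
    The two oblique sides are the paths of the constant words, so [l] and [r]
    are one more than the numbers of letters [false] and [true] of [ts].

    For [alpha = 1] there is one triangle.  If [alpha < 1] then
    [ts = true :: us], and [us] describes the part of the triangle below the
    edge from [0] to [1].  With [X] the sum of [q^w_R] over
    the paths from [1] in that part, and [Y] the sum of [q^(- w_L)] over its
    paths from [0], the paths from [oo] in the whole triangle contribute
    [(q - q^2) q^(- r) X]; those from [0] contribute [q^l Y], or
    [q^(l - size us - 1) X = q^(2 - r) X] when they run through [1], because a
    path from [1] splits the [size us + 1] triangles of the lower part.
    Altogether [v (phi alpha) = q^(1 - r) X + q^l Y] ([v_phi_tip_true]).

    The reflection [x |-> 1 - x] turns the lower part of the triangle of [alpha]
    into that of [1 - alpha], complementing all letters.  It exchanges [l] with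
    [r - 1] and, since it exchanges left and right, [X] with the bar of [Y];
    so it acts on the last formula as the bar involution does. *)

Implicit Types (x y z u a : frac) (t : triangle) (b c d : bool).
Implicit Types (ts w : seq bool) (s : seq frac).

(** * Strips of triangles *)

Definition corner b t : frac := if b then t.2 else t.1.

Definition child t b : triangle :=
  if b then (t.1, bottom t) else (bottom t, t.2).

Definition strip t ts : seq triangle := t :: scanl child t ts.

Definition tri_at t ts i : triangle := foldl child t (take i ts).

Definition tip t ts : frac := bottom (foldl child t ts).

Definition farey t : bool := farey_nbr t.1 t.2.

(** A descending step increases the weight, which excludes all coincidences
    between old and new vertices. *)
Definition wt u : nat := u.1 + u.2.

Lemma size_strip t ts : size (strip t ts) = (size ts).+1.
Proof. by rewrite /= size_scanl. Qed.

Lemma nth_strip t0 t ts i : i <= size ts ->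
  nth t0 (strip t ts) i = tri_at t ts i.
Proof. by move=> le_i; rewrite /strip nth_cons_scanl. Qed.

Lemma tri_atS t ts i : i < size ts ->
  tri_at t ts i.+1 = child (tri_at t ts i) (nth false ts i).
Proof. by move=> lt_i; rewrite /tri_at (take_nth false lt_i) foldl_rcons. Qed.

Lemma tri_at_size t ts : bottom (tri_at t ts (size ts)) = tip t ts.
Proof. by rewrite /tri_at take_size. Qed.

Lemma corner_child_new t c : corner c (child t c) = bottom t.
Proof. by case: c. Qed.

Lemma corner_child_old t c : corner (~~ c) (child t c) = corner (~~ c) t.
Proof. by case: c. Qed.

Lemma farey_child t c : farey t -> farey (child t c).
Proof.
by case: t => -[y1 y2] [z1 z2]; rewrite /farey /farey_nbr; case: c => /=; lia.
Qed.

Lemma farey_tri_at t ts i : farey t -> farey (tri_at t ts i).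
Proof.
move=> ft; rewrite /tri_at; elim: (take i ts) t ft => //= c ts' IH t ft.
exact/IH/farey_child.
Qed.

Lemma wt_corner t b : farey t -> wt (corner b t) < wt (bottom t).
Proof.
by case: t => -[[|y1] [|y2]] [[|z1] [|z2]]; rewrite /farey /farey_nbr /wt;
  case: b => /=; lia.
Qed.

Lemma corner_inj t : farey t -> injective (corner^~ t).
Proof.
case: t => -[y1 y2] [z1 z2]; rewrite /farey /farey_nbr /= => ft [] [] //= [] *;
  subst; lia.
Qed.

Lemma wt_bottom_child t c : farey t -> wt (bottom t) < wt (bottom (child t c)).
Proof.
move=> ft; rewrite -(corner_child_new t c); exact/wt_corner/farey_child.
Qed.

Section Strip.

Variables (t : triangle) (ts : seq bool).
Hypothesis ft : farey t.

Let T := tri_at t ts.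

Lemma wt_bottom_mono i j : i < j -> j <= size ts ->
  wt (bottom (T i)) < wt (bottom (T j)).
Proof.
elim: j => // j IH; rewrite ltnS leq_eqVlt => lt_ij lt_j.
rewrite /T tri_atS //; apply: leq_ltn_trans (wt_bottom_child _ _).
  by case/predU1P: lt_ij => [-> // | lt_ij]; apply/ltnW/IH => //; apply: ltnW.
exact: farey_tri_at.
Qed.

Lemma wt_bottom_le i j : i <= j -> j <= size ts ->
  wt (bottom (T i)) <= wt (bottom (T j)).
Proof.
by rewrite leq_eqVlt => /predU1P[-> // | lt_ij] le_j; apply/ltnW/wt_bottom_mono.
Qed.

Lemma bottom_inj i j : i <= size ts -> j <= size ts ->
  bottom (T i) = bottom (T j) -> i = j.
Proof.
move=> le_i le_j eq_b; case: (ltngtP i j) => // lt.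
  by have := wt_bottom_mono lt le_j; rewrite eq_b ltnn.
by have := wt_bottom_mono lt le_i; rewrite eq_b ltnn.
Qed.

Lemma corner_later i j b : i < j -> j <= size ts ->
  corner b (T j) = corner (~~ nth false ts i) (T i)
  \/ wt (bottom (T i)) <= wt (corner b (T j)).
Proof.
elim: j b => // j IH b; rewrite ltnS leq_eqVlt => lt_ij lt_j.
rewrite /T tri_atS //.
have [->|ne_b] := eqVneq b (nth false ts j).
  right; rewrite corner_child_new.
  by apply: wt_bottom_le (ltnW lt_j); case/predU1P: lt_ij => [-> | /ltnW].
have -> : b = ~~ nth false ts j by move: ne_b; case: (nth _ _ _); case: b.
rewrite corner_child_old; case/predU1P: lt_ij => [-> | lt_ij]; first by left.
exact: IH (ltnW lt_j).
Qed.

(** Replacing a corner is irreversible: later triangles only keep the other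
    corner or acquire heavier ones. *)
Lemma corner_lost i j b : i < j -> j <= size ts ->
  corner b (T j) <> corner (nth false ts i) (T i).
Proof.
move=> lt_ij le_j; case: (corner_later b lt_ij le_j) => [->|].
  move/(corner_inj (farey_tri_at ts i ft)); by case: nth.
move=> le_w eq_c; move: le_w; rewrite eq_c leqNgt.
by rewrite wt_corner ?farey_tri_at.
Qed.

End Strip.

(** * Words and paths *)

(** In a word [b :: w] of sides, [b] is the side of the first triangle. *)
Fixpoint admissible ts b w : bool :=
  match ts, w with
  | c :: ts', b' :: w' => ((b' == c) || (b' == b)) && admissible ts' b' w'
  | [::], [::] => true
  | _, _ => false
  end.

(** A letter that differs from the turn adds no vertex to the path: it waits at
    the corner that the turn keeps. *)
Fixpoint route t ts b w : seq frac :=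
  match ts, w with
  | c :: ts', b' :: w' =>
    if b' == c then corner b t :: route (child t c) ts' b' w'
    else route (child t c) ts' b' w'
  | _, _ => [:: corner b t; bottom t]
  end.

(** The path leaves triangle [i] through its bottom corner; letter [i] of [w] is
    the side of triangle [i.+1]. *)
Definition step ts w i : bool :=
  (i == size ts) || (nth false w i == nth false ts i).

Lemma admissible_size ts b w : admissible ts b w -> size w = size ts.
Proof. by elim: ts b w => [|c ts IH] b [|b' w] //= /andP[_ /IH ->]. Qed.

Lemma admissible_nth ts b w i : admissible ts b w -> i < size ts ->
  (nth false w i == nth false ts i) || (nth false w i == nth false (b :: w) i).
Proof.
elim: ts b w i => [|c ts IH] b [|b' w] // [|i] /andP[] //= _ adm lt_i.
exact: IH.
Qed.

Lemma admissible_nseq ts c : admissible ts c (nseq (size ts) c).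
Proof. by elim: ts => //= c' ts ->; rewrite eqxx orbT. Qed.

Lemma route_cons t ts b w : admissible ts b w ->
  route t ts b w = corner b t :: behead (route t ts b w).
Proof.
elim: ts t b w => [|c ts IH] t b [|b' w] //= /andP[]; case: eqP => //=.
move=> ne_b' /eqP eq_b' adm; rewrite IH //= eq_b'; congr (_ :: _).
have -> : b = ~~ c by case: (b) (c) (b') ne_b' eq_b' => [] [] [].
exact: corner_child_old.
Qed.

Lemma last_route x t ts b w : admissible ts b w ->
  last x (route t ts b w) = tip t ts.
Proof.
elim: ts t b w x => [|c ts IH] t b [|b' w] x //= /andP[_ adm].
by case: eqP => _ /=; apply: IH.
Qed.

Lemma edges_cons2 x y s : edges (x :: y :: s) = (x, y) :: edges (y :: s).
Proof. by []. Qed.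

(** Each edge of a route joins an upper corner of some triangle to its bottom
    corner, and the letter of that triangle tells which upper corner. *)
Lemma edges_routeP t ts b w u v : admissible ts b w ->
  (u, v) \in edges (route t ts b w) <->
  exists i, [/\ i <= size ts, step ts w i,
    u = corner (nth false (b :: w) i) (tri_at t ts i)
    & v = bottom (tri_at t ts i)].
Proof.
elim: ts t b w => [|c ts IH] t b [|b' w] //=.
  move=> _; rewrite inE.
  split=> [/eqP[-> ->]|[[|i] [] //= _ _ -> ->]]; last exact: eqxx.
  by exists 0.
case/andP=> _ adm; have {}IH := IH (child t c) b' w adm.
case: eqP => [eq_b'|ne_b'].
  rewrite (route_cons _ adm) edges_cons2 inE -(route_cons _ adm).
  split=> [/predU1P[|/IH]|[[|i] []]].
  - case=> -> ->; exists 0.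
    by split; rewrite ?eq_b' ?corner_child_new // /step /= eqxx.
  - by case=> i [le_i st_i -> ->]; exists i.+1.
  - move=> _ _ -> ->; apply/predU1P; left.
    by rewrite eq_b' corner_child_new.
  - by move=> le_i st_i eq_u eq_v; apply/predU1P; right; apply/IH; exists i.
split=> [/IH|[[|i] []]].
- by case=> i [le_i st_i -> ->]; exists i.+1.
- by rewrite /step /= => _ /eqP.
- by move=> le_i st_i eq_u eq_v; apply/IH; exists i.
Qed.

Section Route.

Variables (t : triangle) (ts : seq bool) (b : bool) (w : seq bool).
Hypotheses (ft : farey t) (adm : admissible ts b w).

Let T := tri_at t ts.
Let s := route t ts b w.

Lemma uses_sym r u v : uses r u v = uses r v u.
Proof. exact: orbC. Qed.

Lemma uses_route c i : i <= size ts ->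
  uses s (corner c (T i)) (bottom (T i))
  = (nth false (b :: w) i == c) && step ts w i.
Proof.
move=> le_i; have edgesP := edges_routeP t _ _ adm.
apply/orP/andP => [[/edgesP|/edgesP]|].
- case=> j [le_j st_j eq_c /(bottom_inj ft le_i le_j) eq_ij]; subst j.
  by rewrite (corner_inj (farey_tri_at ts i ft) eq_c).
- case=> j [le_j st_j eq_i eq_j].
  have := wt_corner c (farey_tri_at ts i ft).
  have := wt_corner (nth false (b :: w) j) (farey_tri_at ts j ft).
  rewrite -eq_i -eq_j -/(T i); lia.
- case=> /eqP eq_c st_i; left; apply/edgesP.
  by exists i; rewrite eq_c.
Qed.

(** The glued edge joins the corner kept by the turn to the new vertex, so a
    path runs along it when it is on the kept side and then changes sides. *)
Lemma uses_glue i : i < size ts ->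
  uses s (T i.+1).1 (T i.+1).2 = (nth false w i != nth false (b :: w) i).
Proof.
move=> lt_i; have := admissible_nth adm lt_i.
have -> : uses s (T i.+1).1 (T i.+1).2 =
    uses s (corner (~~ nth false ts i) (T i)) (bottom (T i)).
  by rewrite /T tri_atS //; case: (nth false ts i); rewrite //= uses_sym.
rewrite uses_route 1?ltnW // /step ltn_eqF //=.
by case: (nth false ts i); case: nth; case: nth.
Qed.

End Route.

(** * Ancestor triangles are strips *)

Notation top_tri := (fr0, fr_oo).

Lemma tip_cons t c ts : tip t (c :: ts) = tip (child t c) ts.
Proof. by []. Qed.

(** The coefficients are positive because the tip lies strictly between the two
    upper corners. *)
Lemma tip_comb t ts : exists c d : nat, [/\ 0 < c, 0 < d &
  tip t ts = (c * t.1.1 + d * t.2.1, c * t.1.2 + d * t.2.2)].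
Proof.
elim: ts t => [|b ts IH] t; first by exists 1, 1; rewrite /tip /= !mul1n.
rewrite tip_cons; have [c [d [c_gt0 d_gt0 ->]]] := IH (child t b).
case: b; rewrite /child /bottom /farey_sum /=.
  by exists (c + d), d; split; rewrite ?addn_gt0 ?c_gt0 //; congr pair; lia.
by exists c, (c + d); split; rewrite ?addn_gt0 ?c_gt0 //; congr pair; lia.
Qed.

Lemma frac_lt_bottom_tip t c ts : farey t ->
  frac_lt (bottom t) (tip t (c :: ts)) = ~~ c.
Proof.
move=> ft; rewrite tip_cons.
have [m [n [m_gt0 n_gt0 ->]]] := tip_comb (child t c) ts.
move: ft; case: t => -[y1 y2] [z1 z2]; rewrite /farey /farey_nbr /frac_lt.
case: c => /= /eqP nb.
  by apply/negbTE; rewrite -leqNgt; move: (congr1 (muln m) nb); lia.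
by move: (congr1 (muln n) nb); lia.
Qed.

(** The tip is on the correct side of each intermediate vertex, so the search
    for it follows the turns that define it. *)
Lemma ancestors_from_tip n t ts : farey t -> size ts < n ->
  ancestors_from n (tip t ts) t = strip t ts.
Proof.
elim: ts n t => [|c ts IH] [|n] t //= ft lt_n; first by rewrite eqxx.
rewrite frac_lt_bottom_tip // ifF; last first.
  apply/eqP => /(congr1 wt) eq_wt.
  have := @wt_bottom_mono t (c :: ts) ft 0 (size ts).+1 isT (leqnn _).
  by rewrite (tri_at_size t (c :: ts)) -eq_wt ltnn.
rewrite tip_cons.
have -> : (if ~~ c then (bottom t, t.2) else (t.1, bottom t)) = child t c.
  by case: c.
by rewrite IH ?farey_child.
Qed.

Lemma wt_bottom_ge t ts i : farey t -> i <= size ts ->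
  wt (bottom t) + i <= wt (bottom (tri_at t ts i)).
Proof.
move=> ft; elim: i => [|i IH] lt_i; first by rewrite addn0 /tri_at take0.
rewrite addnS; apply: leq_ltn_trans (IH (ltnW lt_i)) _.
exact: wt_bottom_mono.
Qed.

Lemma farey_top : farey top_tri. Proof. by []. Qed.

Lemma ancestors_tip ts : ancestors (tip top_tri ts) = strip top_tri ts.
Proof.
apply: ancestors_from_tip => //.
have := wt_bottom_ge farey_top (leqnn (size ts)).
by rewrite tri_at_size /wt /=; lia.
Qed.

Lemma ancestors_fromE n a t : exists ts, ancestors_from n.+1 a t = strip t ts.
Proof.
elim: n t => [|n IH] t; first by exists [::] => /=; case: ifP.
have -> : ancestors_from n.+2 a t = t :: if bottom t == a then [::] else
    ancestors_from n.+1 a (child t (~~ frac_lt (bottom t) a)).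
  by rewrite /child if_neg.
case: eqP => _; first by exists [::].
have [ts ->] := IH (child t (~~ frac_lt (bottom t) a)).
by exists (~~ frac_lt (bottom t) a :: ts).
Qed.

(** The search for [a] takes some turns anyway, and it ends at [a]. *)
Lemma tip_surj a : coprime a.1 a.2 -> 0 < a.1 -> 0 < a.2 ->
  exists ts, a = tip top_tri ts.
Proof.
move=> cop a1 a2; have := bottom_last_ancestors cop a1 a2.
rewrite /ancestors; case: (_ + _) (ltn_addr a.2 a1) => // n _.
have [ts ->] := ancestors_fromE n a top_tri; move=> <-; exists ts.
by rewrite -nth_last size_strip nth_strip // tri_at_size.
Qed.

(** * Descending paths are routes *)

Lemma is_parent_wt u v : is_parent u v -> wt u < wt v.
Proof.
case/is_parentP => -[p q] [] /andP[/eqP nb /eqP <-]; rewrite /wt /=.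
  by case: p q nb => [|p] [|q] /=; rewrite ?muln0 ?mul0n; lia.
by case: p q nb => [|p] [|q] /=; rewrite ?muln0 ?mul0n; lia.
Qed.

Lemma is_parent_corner c t : farey t -> is_parent (corner c t) (bottom t).
Proof.
move=> ft; apply/is_parentP; exists (corner (~~ c) t); rewrite /parents.
by case: c; [right | left]; rewrite eqxx andbT.
Qed.

Lemma edge_of_corner c t : farey t -> edge_of t (corner c t) (bottom t).
Proof.
move=> ft; apply/and3P; split; last by rewrite !inE eqxx !orbT.
  apply/eqP => /(congr1 wt) eq_wt.
  by have := wt_corner c ft; rewrite eq_wt ltnn.
by rewrite !inE; case: c; rewrite eqxx ?orbT.
Qed.

Definition strip_edge t ts u v : Prop :=
  exists i c, [/\ i <= size ts, u = corner c (tri_at t ts i)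
                & v = bottom (tri_at t ts i)].

Lemma wt_strip_edge t ts u v : farey t -> strip_edge t ts u v -> wt u < wt v.
Proof. by move=> ft [i [c [_ -> ->]]]; apply/wt_corner/farey_tri_at. Qed.

(** The only other edges of a triangle are its top edges; such an edge is an
    oblique edge of the preceding triangle, or joins [0] to [oo], neither of
    which is a parent of the other. *)
Lemma descendsP ts u v :
  descends (tip top_tri ts) u v <-> strip_edge top_tri ts u v.
Proof.
rewrite /descends ancestors_tip; split=> [/andP[/is_parent_wt lt_uv /hasP[t]]|].
  case/(nthP top_tri) => i; rewrite size_strip ltnS => le_i.
  rewrite nth_strip // => <- /and3P[ne_uv].
  set t' := tri_at _ _ _ => u_in v_in.
  have ft' : farey t' by exact: farey_tri_at.
  have [def_v|ne_v] := eqVneq v (bottom t').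
    have [c def_u] : exists c, u = corner c t'.
      move: u_in; rewrite !inE -def_v (negbTE ne_uv) orbF.
      by case/orP => /eqP; [exists false | exists true].
    by exists i, c.
  have [c def_v] : exists c, v = corner c t'.
    move: v_in; rewrite !inE (negbTE ne_v) orbF.
    by case/orP => /eqP; [exists false | exists true].
  have def_u : u = corner (~~ c) t'.
    move: u_in ne_uv; rewrite !inE def_v => /or3P[] /eqP eq_u.
    - by rewrite eq_u; case: (c); rewrite //= eqxx.
    - by rewrite eq_u; case: (c); rewrite //= eqxx.
    - by have := wt_corner c ft'; rewrite -def_v -eq_u; lia.
  case: i @t' le_i {u_in v_in ft' ne_v} def_u def_v => [|i] /= le_i.
    rewrite /tri_at take0 => eu ev.
    by move: lt_uv; rewrite eu ev; case: (c).
  rewrite tri_atS //; have [-> def_u def_v|ne_c] := eqVneq c (nth false ts i).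
    exists i, (~~ nth false ts i); split; first exact: ltnW.
      by rewrite -corner_child_old.
    by rewrite def_v corner_child_new.
  have -> : c = ~~ nth false ts i by case: c ne_c; case: nth.
  rewrite negbK corner_child_new corner_child_old => eu ev; move: lt_uv.
  have := wt_corner (~~ nth false ts i) (farey_tri_at ts i farey_top).
  by rewrite -eu -ev; lia.
case=> i [c [le_i -> ->]]; have fi := farey_tri_at ts i farey_top.
rewrite is_parent_corner // andTb; apply/hasP; exists (tri_at top_tri ts i).
  by rewrite -(nth_strip top_tri) // mem_nth // size_strip.
exact: edge_of_corner.
Qed.

Lemma path_edges (e : rel frac) x s :
  path e x s = all (fun p => e p.1 p.2) (edges (x :: s)).
Proof. by elim: s x => //= y s IH x; rewrite IH. Qed.

Lemma edges_mem2 x s u v : (u, v) \in edges (x :: s) -> v \in s.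
Proof.
move/(map_f snd) => /=; suff -> : [seq i.2 | i <- edges (x :: s)] = s by [].
exact: unzip2_zip.
Qed.

Lemma route_path ts b w : admissible ts b w ->
  is_desc_path (tip top_tri ts) (corner b top_tri) (route top_tri ts b w).
Proof.
move=> adm; have := last_route (corner b top_tri) top_tri adm.
rewrite (route_cons _ adm) /= => ->; rewrite !eqxx path_edges andbT /=.
rewrite -(route_cons _ adm).
apply/allP => -[u v] /(edges_routeP _ _ _ adm)[i [le_i _ -> ->]] /=.
by apply/descendsP; exists i, (nth false (b :: w) i).
Qed.

(** A path that steps at the first triangle moves to the corner created by the
    turn.  Otherwise its next step starts at a corner of a later triangle, so
    by [corner_lost] it waits on the side kept by the turn.  In both cases all
    further steps take place in later triangles because the weight increases. *)
Lemma path_route t ts b s : farey t ->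
    {in edges (corner b t :: s), forall e, strip_edge t ts e.1 e.2} ->
    last (corner b t) s = tip t ts ->
  exists2 w, admissible ts b w & corner b t :: s = route t ts b w.
Proof.
elim: ts t b s => [|c ts IH] t b [|v s] //= ft eP def_tip.
- by have := wt_corner b ft; rewrite def_tip ltnn.
- have [i [c [i0 _ /= def_v]]] := eP (corner b t, v) (mem_head _ _).
  case: s eP def_tip => [|v2 s] eP _.
    by exists [::]; rewrite //= def_v.
  have ev2 : strip_edge t [::] v v2.
    by apply: (eP (v, v2)); rewrite edges_cons2 edges_cons2 !inE eqxx orbT.
  have := wt_strip_edge ft ev2; case: ev2 => j [c' [j0 _ ->]].
  by rewrite def_v /tri_at !take_oversize // ltnn.
- have := wt_bottom_ge ft (leqnn (size (c :: ts))).
  by rewrite tri_at_size -def_tip; have := wt_corner b ft; lia.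
have s_gt : all (fun u => wt v < wt u) s.
  have : path (fun u u' => wt u < wt u') v s.
    rewrite path_edges; apply/allP => e es.
    by apply: (wt_strip_edge ft (eP e _)); rewrite edges_cons2 inE es orbT.
  by apply: order_path_min => u1 u2 u3; apply: ltn_trans.
have lower u u' : strip_edge t (c :: ts) u u' -> wt (bottom t) < wt u' ->
    strip_edge (child t c) ts u u'.
  by case=> [[|i] [c' [le_i -> ->]]]; [rewrite ltnn | exists i, c'].
have [i [c' [le_i /= def_b def_v]]] := eP (corner b t, v) (mem_head _ _).
case: i le_i def_b def_v => [|i] le_i def_b def_v.
  have {}def_v : v = corner c (child t c) by rewrite corner_child_new.
  have [||w adm def_s] := IH (child t c) c s (farey_child c ft).
  - move=> [u u'] es; rewrite -def_v in es; apply: lower.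
      by apply: (eP (u, u')); rewrite edges_cons2 inE es orbT.
    rewrite -(corner_child_new t c) -def_v.
    exact: (allP s_gt) (edges_mem2 es).
  - by rewrite -def_v.
  exists (c :: w); first by rewrite /= eqxx.
  by rewrite /= eqxx -def_s def_v.
have lt_v : wt (bottom t) < wt v.
  by rewrite def_v; apply: (@wt_bottom_mono t (c :: ts) ft 0 i.+1).
have def_c : b = ~~ c.
  have := @corner_lost t (c :: ts) ft 0 i.+1 c' isT le_i.
  by rewrite -def_b /tri_at /=; case: (b) (c) => [] [].
have eq_b : corner b t = corner b (child t c) by rewrite def_c corner_child_old.
have [||w adm def_s] := IH (child t c) b (v :: s) (farey_child c ft).
- rewrite -eq_b => -[u u'] es; apply: lower; first exact: (eP (u, u')).
  have /= := edges_mem2 es; rewrite inE => /predU1P[-> // | /(allP s_gt)].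
  exact: ltn_trans.
- exact: def_tip.
exists (b :: w); first by rewrite /= eqxx orbT.
by rewrite eq_b def_s /= def_c; case: (c).
Qed.

(** The first letter of [w] can be read off the path: it is the first turn when
    the path leaves the first triangle through its bottom corner. *)
Lemma route_inj t ts b w w' :
  farey t -> admissible ts b w -> admissible ts b w' ->
  route t ts b w = route t ts b w' -> w = w'.
Proof.
elim: ts t b w w' => [|c ts IH] t b [|x w] [|x' w'] // ft.
move=> /= /andP[xP adm] /andP[x'P adm'].
have soon r : admissible ts c r ->
    (corner b t, bottom t) \in edges (corner b t :: route (child t c) ts c r).
  by move=> /route_cons ->; rewrite edges_cons2 corner_child_new mem_head.
have late d r : admissible ts d r ->
    (corner b t, bottom t) \notin edges (route (child t c) ts d r).
  move=> adm_r; apply/negP => /(edges_routeP _ _ _ adm_r)[i [le_i _ _ eq_b]].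
  have := wt_bottom_ge (farey_child c ft) le_i; have := wt_bottom_child c ft.
  by rewrite -eq_b; lia.
have ftc := farey_child c ft.
case: eqP xP adm => [->|ne_x] /=; case: eqP x'P adm' => [->|ne_x'] //=.
- by move=> _ adm' _ adm [eq_r]; rewrite (IH _ _ _ _ ftc adm adm' eq_r).
- move=> _ adm' _ adm eq_r; have := soon _ adm.
  by rewrite eq_r (negPf (late _ _ adm')).
- move=> _ adm' _ adm eq_r; have := soon _ adm'.
  by rewrite -eq_r (negPf (late _ _ adm)).
move=> /eqP-> adm' /eqP-> adm eq_r.
by rewrite (IH _ _ _ _ ftc adm adm' eq_r).
Qed.

Fixpoint words ts b : seq (seq bool) :=
  if ts is c :: ts' then
    [seq c :: w | w <- words ts' c]
      ++ (if b == c then [::] else [seq b :: w | w <- words ts' b])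
  else [:: [::]].

Lemma mem_map_cons (c x : bool) w (W : seq (seq bool)) :
  (x :: w \in [seq c :: r | r <- W]) = (x == c) && (w \in W).
Proof.
apply/mapP/andP => [[r rW [-> ->]] | [/eqP-> wW]]; first by rewrite eqxx.
by exists w.
Qed.

Lemma mem_words ts b w : (w \in words ts b) = admissible ts b w.
Proof.
elim: ts b w => [|c ts IH] b [|x w] //=.
  by rewrite mem_cat; case: ifP => _; apply/orP => -[] // /mapP[].
rewrite mem_cat mem_map_cons !IH.
have [->|ne_x] := eqVneq x c; rewrite /= ?orbF.
  case: (eqVneq b c) => [_|ne_b]; rewrite ?orbF //.
  by rewrite mem_map_cons eq_sym (negPf ne_b) orbF.
have [eq_x|ne_b] := eqVneq x b; last first.
  by case: ifP => // _; rewrite mem_map_cons (negPf ne_b).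
by rewrite -eq_x (negPf ne_x) mem_map_cons eqxx IH.
Qed.

Lemma uniq_words ts b : uniq (words ts b).
Proof.
have inj c : injective (cons c : seq bool -> _) by move=> w w' [].
elim: ts b => //= c ts IH b; rewrite cat_uniq (map_inj_uniq (inj c)) IH /=.
case: eqP => //= ne_b; rewrite (map_inj_uniq (inj b)) IH andbT.
apply/hasPn => _ /mapP[w _ ->]; rewrite mem_map_cons.
by case: eqP.
Qed.

Lemma desc_paths_words ts b : desc_paths (corner b top_tri) (tip top_tri ts)
  = [set` [seq route top_tri ts b w | w <- words ts b]]%classic.
Proof.
apply/seteqP; split=> s /=; last first.
  by case/mapP => w; rewrite mem_words => adm ->; apply: route_path.
case: s => // x s /and3P[/eqP -> ]; rewrite path_edges => /allP eP /eqP def_tip.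
have [||w adm ->] := @path_route top_tri ts b s farey_top.
- by move=> e /eP /descendsP.
- exact: def_tip.
by apply: map_f; rewrite mem_words.
Qed.

Lemma sum_desc_paths ts b (F : seq frac -> laurent) :
  (\sum_(s \in desc_paths (corner b top_tri) (tip top_tri ts)) F s
   = \sum_(w <- words ts b) F (route top_tri ts b w))%R.
Proof.
rewrite desc_paths_words -fsbig_seq ?big_map // map_inj_in_uniq ?uniq_words //.
by move=> w w'; rewrite !mem_words => adm adm'; apply: route_inj.
Qed.

(** * The two parts of the ancestor triangle *)

Definition side c a : seq frac := if c then right_side a else left_side a.

(** An oblique side is the path that never changes sides. *)
Lemma rcons_undup_corners t ts c : farey t ->
  rcons (undup (map (corner c) (strip t ts))) (tip t ts)
  = route t ts c (nseq (size ts) c).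
Proof.
elim: ts t => [|c' ts IH] t ft //.
rewrite tip_cons -[strip t _]/(t :: strip (child t c') ts) map_cons.
set C := map _ _; have -> : undup (corner c t :: C) =
  if corner c t \in C then undup C else corner c t :: undup C by [].
rewrite [RHS]/= -IH -/C; last exact: farey_child.
rewrite {}/C; have [<-|ne_c] := eqVneq c c'.
  rewrite ifF //; apply/negbTE/negP => /mapP[t' /(nthP top_tri)[i]].
  rewrite size_strip ltnS => le_i; rewrite nth_strip // => <- /esym.
  exact: (@corner_lost t (c :: ts) ft 0 i.+1 c isT le_i).
rewrite ifT //; have -> : c = ~~ c' by case: (c) (c') ne_c => [] [].
by rewrite -corner_child_old; apply: mem_head.
Qed.

Lemma side_route ts c :
  side c (tip top_tri ts) = route top_tri ts c (nseq (size ts) c).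
Proof.
rewrite -rcons_undup_corners // -ancestors_tip /side /left_side /right_side.
by case: c.
Qed.

Lemma size_edges_side ts c :
  size (edges (side c (tip top_tri ts))) = (count_mem c ts).+1.
Proof.
rewrite side_route size_zip size_behead (minn_idPr (leq_pred _)).
suff gen t : size (route t ts c (nseq (size ts) c)) = (count_mem c ts).+2.
  by rewrite gen.
elim: ts t => //= c' ts IH t; rewrite eq_sym.
by case: eqP => _ /=; rewrite IH.
Qed.

Lemma lnum_tip ts : lnum (tip top_tri ts) = (count_mem false ts).+1.
Proof. exact: (size_edges_side ts false). Qed.

Lemma rnum_tip ts : rnum (tip top_tri ts) = (count_mem true ts).+1.
Proof. exact: (size_edges_side ts true). Qed.

Lemma card_set_nth N r c : size r = N ->
  #|[set n : 'I_N | nth false r n == c]%SET| = count_mem c r.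
Proof.
by move=> <-; rewrite cardsE -sum1_card -sum1_count (big_nth false) big_mkord.
Qed.

Section Parts.

Variables (ts : seq bool) (b : bool) (w : seq bool).
Hypothesis adm : admissible ts b w.

Let a := tip top_tri ts.
Let s := route top_tri ts b w.
Let T := tri_at top_tri ts.

Lemma tri_tip n : n <= size ts -> tri a n = T n.
Proof. by move=> le_n; rewrite /tri ancestors_tip nth_strip. Qed.

Lemma size_anc : size (ancestors a) = (size ts).+1.
Proof. by rewrite ancestors_tip size_strip. Qed.

Lemma edges_sideP c u v : (u, v) \in edges (side c a) <->
  exists j, [/\ j <= size ts, (j == size ts) || (nth false ts j == c),
    u = corner c (T j) & v = bottom (T j)].
Proof.
rewrite /a side_route; split.
  case/(edges_routeP _ _ _ (admissible_nseq ts c)) => j [le_j st_j].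
  have -> : nth false (c :: nseq (size ts) c) j = c.
    by case: j le_j {st_j} => //= j lt_j; rewrite nth_nseq lt_j.
  move=> -> ->; exists j; split=> //; move: st_j; rewrite /step nth_nseq.
  by case: ltngtP le_j => //= _ _; rewrite eq_sym.
case=> j [le_j st_j -> ->]; apply/(edges_routeP _ _ _ (admissible_nseq ts c)).
exists j; split=> //.
  rewrite /step nth_nseq; case: ltngtP le_j st_j => //= _ _.
  by rewrite eq_sym.
by case: j le_j {st_j} => //= j lt_j; rewrite nth_nseq lt_j.
Qed.

(** An edge from an upper corner to the bottom corner is also an edge of the
    next triangle when the turn keeps that corner; the third hypothesis excludes
    this because it puts the edge on the boundary of the strip. *)
Lemma side_edge_uniq c n j : n <= size ts -> j <= size ts ->
    (j == size ts) || (nth false ts j == c) ->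
    corner c (T j) \in corners (T n) -> bottom (T j) \in corners (T n) -> j = n.
Proof.
move=> le_n le_j st_j c_in b_in; have fn := farey_tri_at ts n farey_top.
have le_b u : u \in corners (T n) -> wt u <= wt (bottom (T n)).
  rewrite !inE => /or3P[] /eqP-> //; apply: ltnW.
    exact: (wt_corner false fn).
  exact: (wt_corner true fn).
case: (ltngtP j n) => // [lt_jn|lt_nj]; last first.
  by have := wt_bottom_mono farey_top lt_nj le_j; rewrite ltnNge le_b.
have def_c : nth false ts j = c.
  case/orP: st_j => /eqP // eq_j.
  by move: (leq_trans lt_jn le_n); rewrite eq_j ltnn.
have lost d := @corner_lost top_tri ts farey_top j n d lt_jn le_n.
have fj := farey_tri_at ts j farey_top.
move: c_in; rewrite !inE => /or3P[] /eqP eq_c.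
- by case: (lost false); rewrite def_c -[RHS]/(corner c (T j)) eq_c.
- by case: (lost true); rewrite def_c -[RHS]/(corner c (T j)) eq_c.
have := wt_bottom_mono farey_top lt_jn le_n; have := wt_corner c fj.
by rewrite -/(T j) -/(T n) eq_c; lia.
Qed.

Lemma has_side_edge c n : n <= size ts ->
  has (fun e => edge_of (tri a n) e.1 e.2 && ~~ uses s e.1 e.2)
      (edges (side c a))
  = (nth false (b :: w) n == ~~ c) && ((n == size ts) || (nth false ts n == c)).
Proof.
move=> le_n; rewrite tri_tip //; apply/hasP/andP.
  case=> -[u v] /edges_sideP[j [le_j st_j -> ->]] /= /andP[/and3P[_ u_in v_in]].
  have eq_jn := side_edge_uniq le_n le_j st_j u_in v_in; subst j.
  rewrite uses_route // st_j => not_used; split=> //.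
  move: not_used st_j (admissible_nth adm (i := n)); rewrite /step.
  case: ltngtP le_n => //= [lt_n|->] _; last by case: nth; case: (c).
  by move=> + + /(_ isT); case: nth; case: nth; case: nth; case: (c).
case=> /eqP side_n st_n; exists (corner c (T n), bottom (T n)).
  by apply/edges_sideP; exists n.
by rewrite /= uses_route // side_n edge_of_corner ?farey_tri_at //; case: (c).
Qed.

(** Triangles that are connected without crossing the path have the same letter,
    and if a triangle with letter [c] has a boundary edge on side [c], the path
    covers it.  Conversely, going down from a triangle with the opposite letter
    to the first triangle that has a boundary edge on side [c] never crosses the
    path: on the way all turns replace the corner on the other side, where the
    path is, so the letter persists. *)
Lemma part_along_side c : part_along (side c a) a s
  = [set n : 'I_(size (ancestors a)) | nth false (b :: w) n == ~~ c]%SET.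
Proof.
have le_ts (n : 'I_(size (ancestors a))) : n <= size ts.
  by rewrite -ltnS -size_anc.
pose B n := nth false (b :: w) n.
have glueE (m n : 'I_(size (ancestors a))) :
    glued_below s m n = (n == m.+1 :> nat) && (B m == B n).
  rewrite /glued_below; case: eqP => //= def_n.
  have lt_m : m < size ts by have := le_ts n; rewrite def_n.
  by rewrite !tri_tip // def_n uses_glue // negbK eq_sym.
apply/setP => m; rewrite !inE; apply/existsP/idP => [[n]|].
  rewrite has_side_edge //= => /and3P[conn side_n _].
  have clo : closed (fun m n => glued_below s m n || glued_below s n m)
      [pred n : 'I_(size (ancestors a)) | B n == ~~ c].
    move=> x y /=; rewrite !glueE !inE.
    by case/orP => /andP[_ /eqP ->].
  by have := closed_connect clo conn; rewrite !inE side_n => ->.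
have [k le_k] := ubnP (size ts - m); elim: k m le_k => // k IH m le_k side_m.
have [last_m|] := boolP ((m == size ts :> nat) || (nth false ts m == c)).
  by exists m; rewrite connect0 has_side_edge // side_m.
rewrite negb_or => /andP[ne_m ne_c].
have lt_m : m < size ts by rewrite ltn_neqAle ne_m le_ts.
have lt_m1 : m.+1 < size (ancestors a) by move: lt_m; rewrite -ltnS -size_anc.
have eq_B : B m.+1 = B m.
  move: (admissible_nth adm lt_m) side_m ne_c; rewrite /B /=.
  by case: nth; case: nth; case: nth; case: (c).
have [||n /andP[conn hn]] := IH (Ordinal lt_m1).
- by rewrite /=; lia.
- by rewrite -[nth _ _ _]/(B m.+1) eq_B.
exists n; rewrite hn andbT; apply: connect_trans conn; apply: connect1.
by rewrite glueE eqxx -/(B m.+1) /= eq_B eqxx.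
Qed.

Lemma card_part_along c :
  #|part_along (side c a) a s| = count_mem (~~ c) (b :: w).
Proof.
by rewrite part_along_side card_set_nth // size_anc /= (admissible_size adm).
Qed.

End Parts.

Lemma w_L_route ts b w : admissible ts b w ->
  w_L (tip top_tri ts) (route top_tri ts b w) = count_mem true (b :: w).
Proof. by move=> adm; apply: (card_part_along adm false). Qed.

Lemma w_R_route ts b w : admissible ts b w ->
  w_R (tip top_tri ts) (route top_tri ts b w) = count_mem false (b :: w).
Proof. by move=> adm; apply: (card_part_along adm true). Qed.

(** * Reflection *)

(** [x' = 1 - x], in a form that Farey sums visibly preserve. *)
Definition reflected x x' : bool := (x.1 + x'.1 == x.2) && (x'.2 == x.2).

Lemma reflectedE x x' : reflected x x' -> x' = (x.2 - x.1, x.2)%N.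
Proof.
by case: x x' => [p q] [p' q'] /andP[/= /eqP <- /eqP ->]; rewrite addKn.
Qed.

Lemma reflected_farey_sum x x' y y' : reflected x x' -> reflected y y' ->
  reflected (farey_sum x y) (farey_sum y' x').
Proof. by rewrite /reflected /=; lia. Qed.

Lemma reflected_tip t t' ts : reflected t.1 t'.2 -> reflected t.2 t'.1 ->
  reflected (tip t ts) (tip t' (map negb ts)).
Proof.
elim: ts t t' => [|c ts IH] t t' r1 r2; first exact: reflected_farey_sum.
rewrite map_cons !tip_cons.
by case: c; apply: IH => //; apply: reflected_farey_sum.
Qed.

Lemma words_negb ts b :
  words (map negb ts) (~~ b) = map (map negb) (words ts b).
Proof.
elim: ts b => //= c ts IH b; rewrite map_cat (inj_eq negb_inj) -!map_comp.
congr (_ ++ _); first by rewrite IH -map_comp.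
by case: ifP => // _; rewrite IH -!map_comp.
Qed.

(** * The value of [v] *)

Local Open Scope ring_scope.

Definition q4 : laurent := - A ^+ 4.

Lemma q4_unit : q4 \is a GRing.unit.
Proof. by rewrite unitrN unitrX ?A_unit. Qed.

Lemma bar_q4 (k : int) : bar (q4 ^ k) = q4 ^ (- k).
Proof.
rewrite rmorphXz ?q4_unit // -exprz_inv /q4 rmorphN rmorphXn /=.
by rewrite bar_A exprVn invrN.
Qed.

Lemma delta_A6 : A ^+ 6 * delta = q4 - q4 ^+ 2.
Proof.
have A6V : A ^+ 6 * A ^- 2 = A ^+ 4.
  by rewrite (exprD A 4 2) mulrK ?unitrX ?A_unit.
by rewrite /delta mulrBr mulrN -exprD A6V /q4 sqrrN -exprM addrC.
Qed.

(** The sums [X] and [Y] for the strip with turns [ts]. *)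
Definition sum_right ts : laurent :=
  \sum_(w <- words ts true) q4 ^ (count_mem false w : int).

Definition sum_left ts : laurent :=
  \sum_(w <- words ts false) q4 ^ (- (count_mem true w : int)).

Lemma count_negb c w : count_mem c (map negb w) = count_mem (~~ c) w.
Proof. by rewrite count_map; apply: eq_count; case: c => -[]. Qed.

Lemma count_true_false w : (count_mem true w + count_mem false w = size w)%N.
Proof.
rewrite -(count_predC (pred1 true) w); congr (_ + _)%N.
by apply: eq_count => -[].
Qed.

Lemma bar_sum_right ts : bar (sum_right ts) = sum_left (map negb ts).
Proof.
rewrite /sum_left (words_negb ts true) big_map rmorph_sum.
by apply: eq_bigr => w _; rewrite /= bar_q4 count_negb.
Qed.

Lemma bar_sum_left ts : bar (sum_left ts) = sum_right (map negb ts).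
Proof. by apply: (can_inj barK); rewrite barK bar_sum_right (mapK negbK). Qed.

Lemma v_phi_tip ts : v (phi (tip top_tri ts)) =
  (q4 - q4 ^+ 2) * q4 ^ (- (count_mem true ts).+1%:Z) * sum_right ts
  + q4 ^ (count_mem false ts).+1 * sum_left ts.
Proof.
have [m [n [m_gt0 n_gt0 tipE]]] := tip_comb top_tri ts.
have ne_oo : (tip top_tri ts == fr_oo) = false.
  by rewrite tipE; apply/eqP => -[]; rewrite /=; lia.
have ne_0 : (tip top_tri ts == fr0) = false.
  by rewrite tipE; apply/eqP => -[]; rewrite /=; lia.
rewrite /phi ne_oo ne_0 vE lnum_tip rnum_tip.
rewrite (sum_desc_paths ts true) (sum_desc_paths ts false) -/q4.
congr (_ + _).
  rewrite mulrAC -[_ * _ * delta]mulrAC delta_A6 -exprnN; congr (_ * _).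
  rewrite /sum_right !big_seq; apply: eq_bigr => w; rewrite mem_words => adm.
  by rewrite w_R_route.
congr (_ * _); rewrite /sum_left !big_seq; apply: eq_bigr => w.
by rewrite mem_words => adm; rewrite w_L_route // -exprnN.
Qed.

(** The first turn forces the paths from [oo] through [1]; the paths from [0]
    that also run through [1] cancel the [q^2] term of [A^6 * delta]. *)
Lemma v_phi_tip_true ts : v (phi (tip top_tri (true :: ts))) =
  q4 ^ (- (count_mem true ts).+1%:Z) * sum_right ts
  + q4 ^ (count_mem false ts).+1 * sum_left ts.
Proof.
have right_cons : sum_right (true :: ts) = sum_right ts.
  by rewrite /sum_right /= cats0 big_map.
have left_cons : sum_left (true :: ts) =
    q4 ^ (- (size ts).+1%:Z) * sum_right ts + sum_left ts.
  rewrite /sum_left /= big_cat !big_map /=; congr (_ + _).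
  rewrite /sum_right mulr_sumr !big_seq; apply: eq_bigr => w.
  rewrite mem_words => /admissible_size size_w; rewrite -exprzDr ?q4_unit //.
  congr (_ ^ _); have := count_true_false w; rewrite size_w.
  by move: (count_mem true w) (count_mem false w) (size ts); lia.
have q4D := exprzDr q4_unit.
rewrite v_phi_tip right_cons left_cons /= mulrDr addrA; congr (_ + _).
rewrite [in LHS]mulrA -mulrDl; congr (_ * _).
rewrite mulrBl.
have -> : q4 * q4 ^ (- (1 + count_mem true ts).+1%:Z) =
    q4 ^ (- (count_mem true ts).+1%:Z).
  by rewrite -{1}[q4]expr1z -q4D; congr (_ ^ _); lia.
have -> : q4 ^+ 2 * q4 ^ (- (1 + count_mem true ts).+1%:Z) =
    q4 ^ (- (count_mem true ts)%:Z).
  by rewrite -[q4 ^+ 2]/(q4 ^ 2%:Z) -q4D; congr (_ ^ _); lia.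
have -> : q4 ^ (count_mem false ts).+1 * q4 ^ (- (size ts).+1%:Z) =
    q4 ^ (- (count_mem true ts)%:Z).
  rewrite -q4D; congr (_ ^ _); have := count_true_false ts.
  by move: (count_mem true ts) (count_mem false ts) (size ts); lia.
by rewrite subrK.
Qed.

Theorem theorem3p17 (p q : nat) (cop_pq : coprime p q)
    (p_ge1 : (1 <= p)%N) (p_le_q : (p <= q)%N) :
  bar (v (phi (p, q))) = v (phi ((q - p)%N, q)).
Proof.
have q_ge1 := leq_trans p_ge1 p_le_q.
have [ts def_pq] := tip_surj (a := (p, q)) cop_pq p_ge1 q_ge1.
have := def_pq.
have [m [n [m_gt0 n_gt0 tipE]]] :=
  tip_comb (child top_tri (head true ts)) (behead ts).
case: ts def_pq tipE => [|[] ts] def_pq /= tipE.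
- case=> -> ->; rewrite -[(1, 1)%N]/(tip top_tri [::]) v_phi_tip.
  rewrite /sum_right /sum_left /= !big_seq1 /= expr0z !mulr1.
  rewrite mulrBl mulrV ?q4_unit // exprS expr1 mulrK ?q4_unit // subrK rmorph1.
  by rewrite /v /phi /= mul0r add0r.
- move=> _; pose lower := child top_tri true.
  have := @reflected_tip lower lower ts isT isT.
  rewrite /lower -!tip_cons -def_pq => /reflectedE <-.
  rewrite def_pq !v_phi_tip_true !count_negb /= rmorphD !rmorphM /= !bar_q4.
  by rewrite bar_sum_right bar_sum_left opprK addrC.
(* After a first turn to the right p is larger than q. *)
- rewrite tip_cons tipE; case=> eq_p eq_q.
  by move: p_le_q; rewrite eq_p eq_q /=; lia.
Qed.
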